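(* Let $I=(G=(V,E),\mathcal{C},\omega,n-1,b)$ be an instance of \textsc{Connectivity NWS} with $n=|V|$ such that the hypergraph $(V,\mathcal{C})$ is connected. Consider the following algorithm: if $G$ is not connected, output that there is no solution; otherwise, let $X-1$ be the maximum edge weight in $G$, define for each edge $e$ the weight $\widetilde\omega(e)=z_e+\frac{X-\omega(e)}{X}$ where $z_e$ is the number of communities containing both endpoints of $e$, compute with Kruskal's algorithm a maximum-weight spanning tree $T$ of $G$ with respect to $\widetilde\omega$, output $T$ if $T$ is a solution for $I$, and otherwise output that there is no solution. This algorithm runs in $\mathcal{O}(m\cdot(c+\log n))$ time and either finds a minimum-weight solution for $I$ or correctly outputs that $I$ has no solution.
   Context: \textsc{Connectivity NWS}: given a graph $G=(V,E)$ with $m$ edges, a collection $\mathcal{C}$ of $c$ subsets of $V$ (communities), $\omega:E\to\mathbb{R}_+$, an integer $\ell$ and a positive real $b$, a solution is a spanning subgraph $G'=(V,E')$ with $E'\subseteq E$, $|E'|\le\ell$, $\omega(E')\le b$, such that $G'[C]$ is connected for all $C\in\mathcal{C}$. The hypergraph $(V,\mathcal{C})$ is connected if any two vertices are joined by a sequence of communities, consecutive ones intersecting, the first containing one vertex and the last the other. *)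

(* Defs.v *)
From HB Require Import structures.
From mathcomp Require Export all_boot all_order all_algebra reals.

Set Implicit Arguments.
Unset Strict Implicit.
Unset Printing Implicit Defensive.

Import Order.TTheory GRing.Theory Num.Theory.

Local Open Scope ring_scope.

Section Problem.

Variables (R : realFieldType) (V : finType).

(* Communities form a sequence, so c is its size and a community that occurs
   several times is counted with multiplicity.  Values of [omega] outside
   [edges] are irrelevant. *)
Record cnws := Cnws {
  edges : {set {set V}};
  comms : seq {set V};
  omega : {set V} -> R;
  ell : int;
  budget : R;
  edges_card2 : forall e, e \in edges -> #|e| = 2;
  omega_ge0 : forall e, e \in edges -> 0 <= omega e;
  budget_gt0 : 0 < budget
}.

Definition adj (F : {set {set V}}) : rel V := [rel x y | [set x; y] \in F].

(* The graph (W, F), whose edges are assumed to lie inside W, is connected. *)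
Definition connected_graph (W : {set V}) (F : {set {set V}}) : Prop :=
  forall x y, x \in W -> y \in W -> connect (adj F) x y.

Definition induced_edges (F : {set {set V}}) (C : {set V}) : {set {set V}} :=
  [set e in F | e \subset C].

Definition weight (I : cnws) (F : {set {set V}}) : R :=
  \sum_(e in F) omega I e.

Definition solution (I : cnws) (F : {set {set V}}) : Prop :=
  [/\ F \subset edges I,
      #|F|%:Z <= ell I,
      weight I F <= budget I &
      forall C, C \in comms I -> connected_graph C (induced_edges F C)].

Definition min_weight_solution (I : cnws) (F : {set {set V}}) : Prop :=
  solution I F /\ forall F', solution I F' -> weight I F <= weight I F'.

Definition hypergraph_connected (cs : seq {set V}) : Prop :=
  forall u v : V, u != v ->
  exists (C : {set V}) (s : seq {set V}),
    [/\ {subset C :: s <= cs},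
        path [rel A B : {set V} | A :&: B != set0] C s,
        u \in C &
        v \in last C s].

End Problem.

(* Cost model.  A computation returns the number of steps together with its
   result.  Every unfolding of a recursive function below costs one step, and
   between two steps only a bounded number of unit-cost operations of a real
   RAM is performed: arithmetic and comparisons on numbers, tests on vertices,
   construction and destruction of list cells, reading and writing a cell of an
   array indexed by V, and the test whether a vertex lies in a community.
   The number n = #|V| is known to the machine, which can run through the
   vertices; allocating an array indexed by V costs n steps. *)

Definition timed (A : Type) : Type := (nat * A)%type.

Definition cost A (t : timed A) : nat := t.1.
Definition result A (t : timed A) : A := t.2.

Definition ret A (a : A) : timed A := (0%N, a).
Definition charge A (k : nat) (t : timed A) : timed A := ((k + t.1)%N, t.2).
Definition tick A (t : timed A) : timed A := charge 1 t.
Definition bind A B (t : timed A) (f : A -> timed B) : timed B :=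
  charge t.1 (f t.2).

Notation "'let*' x ':=' t 'in' k" := (bind t (fun x => k))
  (at level 200, x name, t at level 100, k at level 200).

Section ListPrograms.

Variables A B : Type.

(* [p], [f] in [countT] and [foldT] must be unit-cost operations. *)
Fixpoint countT (p : pred A) (s : seq A) : timed nat :=
  tick (if s is x :: s' then
          let* k := countT p s' in ret (p x + k)%N
        else ret 0%N).

Fixpoint foldT (f : A -> B -> B) (b : B) (s : seq A) : timed B :=
  tick (if s is x :: s' then
          let* r := foldT f b s' in ret (f x r)
        else ret b).

Fixpoint mapT (f : A -> timed B) (s : seq A) : timed (seq B) :=
  tick (if s is x :: s' then
          let* y := f x in
          let* r := mapT f s' in
          ret (y :: r)
        else ret [::]).

Fixpoint allT (p : A -> timed bool) (s : seq A) : timed bool :=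
  tick (if s is x :: s' then
          let* b := p x in
          if b then allT p s' else ret false
        else ret true).

End ListPrograms.

(* Bottom-up merge sort; [le] must be a unit-cost comparison. *)
Section MergeSort.

Variables (A : Type) (le : rel A).

Fixpoint mergeT (s1 : seq A) : seq A -> timed (seq A) :=
  fix mergeT_s1 (s2 : seq A) : timed (seq A) :=
    tick (match s1, s2 with
          | [::], _ => ret s2
          | _, [::] => ret s1
          | x1 :: s1', x2 :: s2' =>
              if le x1 x2 then
                let* s := mergeT s1' s2 in ret (x1 :: s)
              else
                let* s := mergeT_s1 s2' in ret (x2 :: s)
          end).

Fixpoint merge_pairsT (ss : seq (seq A)) : timed (seq (seq A)) :=
  tick (match ss with
        | s1 :: s2 :: ss' =>
            let* s := mergeT s1 s2 in
            let* r := merge_pairsT ss' in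
            ret (s :: r)
        | _ => ret ss
        end).

(* [fuel] only serves termination: [size ss] is always sufficient. *)
Fixpoint merge_allT (fuel : nat) (ss : seq (seq A)) : timed (seq A) :=
  tick (match ss, fuel with
        | [::], _ => ret [::]
        | [:: s], _ => ret s
        | s :: _, 0 => ret s
        | _, fuel'.+1 =>
            let* ss' := merge_pairsT ss in
            merge_allT fuel' ss'
        end).

Definition sortT (s : seq A) : timed (seq A) :=
  let* ss := mapT (fun x => ret [:: x]) s in
  merge_allT (size s) ss.

End MergeSort.

Section Algorithm.

Variables (R : realFieldType) (V : finType).

(* An edge as stored by the machine: its two ends and its weight. *)
Record edge := Edge { src : V; dst : V; wgt : R }.

Definition ends (e : edge) : {set V} := [set src e; dst e].

(* [es] lists every edge of the instance exactly once, in any order and with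
   either orientation. *)
Definition encodes (I : cnws R V) (es : seq edge) : Prop :=
  perm_eq (map ends es) (enum (edges I)) /\
  map wgt es = map (omega I \o ends) es.

Definition edge_set (T : seq edge) : {set {set V}} :=
  [set f in map ends T].

(* Disjoint-set forest with union by size. *)
Record dsf := Dsf { parent : V -> V; card_of : V -> nat }.

Definition write A (a : V -> A) (x : V) (y : A) : V -> A :=
  fun z => if z == x then y else a z.

Definition new_dsf : timed dsf :=
  charge (#|V| + #|V|) (ret (Dsf id (fun=> 1%N))).

(* [fuel] only serves termination: [#|V|] is always sufficient. *)
Fixpoint findT (d : dsf) (fuel : nat) (x : V) : timed V :=
  tick (if parent d x == x then ret x
        else if fuel is fuel'.+1 then findT d fuel' (parent d x)
        else ret x).

Definition link (d : dsf) (x y : V) : dsf :=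
  let k := (card_of d x + card_of d y)%N in
  if (card_of d x < card_of d y)%N
  then Dsf (write (parent d) x y) (write (card_of d) y k)
  else Dsf (write (parent d) y x) (write (card_of d) x k).

Fixpoint greedyT (d : dsf) (es : seq edge) : timed (seq edge) :=
  tick (if es is e :: es' then
          let* x := findT d #|V| (src e) in
          let* y := findT d #|V| (dst e) in
          if x == y then greedyT d es'
          else
            let* F := greedyT (link d x y) es' in
            ret (e :: F)
        else ret [::]).

Definition greedy_forestT (es : seq edge) : timed (seq edge) :=
  let* d := new_dsf in greedyT d es.

(* A graph is connected iff it has a spanning forest with n - 1 edges.  With
   fewer than n - 1 edges the answer is given before allocating any array. *)
Definition connectedT (es : seq edge) : timed bool :=
  let* m := countT predT es in
  if (m.+1 < #|V|)%N then ret false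
  else
    let* F := greedy_forestT es in
    let* k := countT predT F in
    ret (#|V| <= k.+1)%N.

(* X, where X - 1 is the maximum edge weight (0 if there is no edge). *)
Definition maxweight1T (es : seq edge) : timed R :=
  let* w := foldT (fun e r => Num.max (wgt e) r) 0 es in
  ret (w + 1).

Definition tilde_omegaT (cs : seq {set V}) (X : R) (e : edge) : timed R :=
  let* z := countT (fun C : {set V} => (src e \in C) && (dst e \in C)) cs in
  ret (z%:R + (X - wgt e) / X).

(* Kruskal's algorithm for a maximum-weight spanning tree: [ks] lists the edges
   together with their weights. *)
Definition kruskalT (ks : seq (edge * R)) : timed (seq edge) :=
  let* ks' := sortT (fun p q : edge * R => q.2 <= p.2) ks in
  let* es := mapT (fun p => ret p.1) ks' in
  greedy_forestT es.

(* T is a forest, hence T[C] is connected iff it has at least |C| - 1 edges. *)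
Definition comm_connectedT (T : seq edge) (C : {set V}) : timed bool :=
  let* k := countT (fun v => v \in C) (enum V) in
  let* l := countT (fun e => (src e \in C) && (dst e \in C)) T in
  ret (k <= l.+1)%N.

Definition is_solutionT (cs : seq {set V}) (l : int) (b : R) (T : seq edge) :
    timed bool :=
  let* k := countT predT T in
  let* w := foldT (fun e r => wgt e + r) 0 T in
  if (k%:Z <= l) && (w <= b) then allT (comm_connectedT T) cs else ret false.

(* [None] means: there is no solution. *)
Definition algorithm (es : seq edge) (cs : seq {set V}) (l : int) (b : R) :
    timed (option (seq edge)) :=
  let* conn := connectedT es in
  if ~~ conn then ret None
  else
    let* X := maxweight1T es in
    let* ks := mapT (fun e => let* w := tilde_omegaT cs X e in ret (e, w)) es in
    let* T := kruskalT ks in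
    let* ok := is_solutionT cs l b T in
    ret (if ok then Some T else None).

End Algorithm.

(* Main.v *)
Require Import Defs.
From mathcomp Require Import zify ring lra.

Set Implicit Arguments.
Unset Strict Implicit.
Unset Printing Implicit Defensive.

Import Order.TTheory GRing.Theory Num.Theory.

Local Open Scope ring_scope.

(* Over F_2 the incidence vectors of a set of edges are free iff the edges form
   a forest, and x, y are connected by the edges iff the sum of the unit vectors
   of x and y lies in the span.  Kruskal's algorithm is thus the greedy
   construction of a basis from a sorted list of vectors, which is optimal for
   every weight that is monotone along the list.  The list sorted by
   tilde_omega is sorted lexicographically, so the greedy tree T is optimal both
   for the multiplicity z and for tilde_omega, although the fractional parts may
   add up to more than 1.

   A forest has at most |C| - 1 edges inside a community C, with equality iff it
   connects C; summing over the communities, the solutions are the spanning trees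
   within budget whose total multiplicity attains this bound.  If a solution F
   exists, then z(T) >= z(F) forces T to connect every community, and
   z(T) = z(F) together with the optimality for tilde_omega gives
   omega(T) <= omega(F).

   For the running time, union by size keeps 2^(depth of x) below the size of the
   tree of x, and m <= n^2 bounds the number of rounds of the merge sort by
   2 (log n + 1). *)

(** * Greedy bases of lists of vectors *)

Section Greedy.

Variables (K : fieldType) (vT : vectType K) (E : Type) (vec : E -> vT).

Fixpoint greedy (U : {vspace vT}) (es : seq E) : seq E :=
  if es is e :: es' then
    if vec e \in U then greedy U es' else e :: greedy (U + <[vec e]>) es'
  else [::].

Lemma size_greedy U es : (size (greedy U es) <= size es)%N.
Proof.
by elim: es U => //= e es IH U; case: ifP => _ /=; rewrite ?ltnS ?leqW // ?IH.
Qed.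

(** A skipped vector already lies in the current space, so the space reached after [es1] is [U] plus
    the span of all of [es1], not only of the selected part. *)
Lemma greedy_cat U es1 es2 :
  greedy U (es1 ++ es2) =
  greedy U es1 ++ greedy (U + <<map vec es1>>) es2.
Proof.
elim: es1 U => [|e es1 IH] U /=; first by rewrite span_nil addv0.
rewrite span_cons addvA; case: ifP => [eU|_]; rewrite IH //.
by rewrite (addv_idPl (_ : (<[vec e]> <= U)%VS)).
Qed.

Lemma span_greedy U es : (U + <<map vec (greedy U es)>> = U + <<map vec es>>)%VS.
Proof.
elim: es U => //= e es IH U; rewrite span_cons addvA.
case: ifP => [eU|_] /=; last by rewrite span_cons addvA IH.
by rewrite IH [in RHS](addv_idPl (_ : (<[vec e]> <= U)%VS)).
Qed.

(** Each selected vector lies outside the space built so far and raises the dimension by exactly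
    one. *)
Lemma dim_add_greedy U es :
  \dim (U + <<map vec (greedy U es)>>) = (\dim U + size (greedy U es))%N.
Proof.
elim: es U => [|e es IH] U /=; first by rewrite span_nil addv0 addn0.
case: ifP => [eU|eU] //=; rewrite span_cons addvA IH addnS -addSn; congr addn.
rewrite dimv_disjoint_sum ?dim_vline; last first.
  apply/eqP; rewrite -subv0; apply/subvP => v; rewrite memv_cap memv0.
  case/andP=> vU /vlineP[k vE]; apply/eqP; case: (eqVneq k 0) => [k0|k0].
    by rewrite vE k0 scale0r.
  by move: eU vU; rewrite vE rpredZeq (negPf k0) /= => ->.
suff -> : vec e != 0 by rewrite addn1.
by apply: contraFneq eU => ->; rewrite mem0v.
Qed.

Lemma size_greedy_dim es : size (greedy 0 es) = \dim <<map vec es>>.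
Proof. by rewrite -[X in \dim X]add0v -span_greedy dim_add_greedy dimv0. Qed.

Lemma free_greedy es : free (map vec (greedy 0 es)).
Proof.
by rewrite /free -[X in \dim X]add0v dim_add_greedy dimv0 size_map.
Qed.

End Greedy.

Lemma greedy_subseq (K : fieldType) (vT : vectType K) (E : eqType)
    (vec : E -> vT) U es :
  subseq (greedy vec U es) es.
Proof.
elim: es U => //= e es IH U; case: ifP => _; last by rewrite eqxx.
by apply: subseq_trans (IH U) (subseq_cons _ _).
Qed.

(** * Optimality of the greedy basis of a sorted list *)

Section GreedyOptimal.

Variables (K : fieldType) (vT : vectType K) (E : Type) (vec : E -> vT).

Lemma sub_map_filter (p : pred E) es :
  {subset map vec (filter p es) <= map vec es}.
Proof.
elim: es => //= e es IH v; case: (p e) => /=; rewrite !inE.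
  by case/orP=> [->//|/IH ->]; rewrite orbT.
by move/IH ->; rewrite orbT.
Qed.

Lemma free_map_filter (p : pred E) es :
  free (map vec es) -> free (map vec (filter p es)).
Proof.
elim: es => //= e es IH; rewrite free_cons => /andP[eV /IH fr].
case: (p e) => //=; rewrite free_cons fr andbT.
by apply: contra eV; apply/subvP; apply: sub_span; apply: sub_map_filter.
Qed.

Lemma dim_span_filter (p : pred E) es :
  (\dim <<map vec (filter p es)>> <= \dim <<map vec es>>)%N.
Proof. by apply/dimvS/sub_span/sub_map_filter. Qed.

Variables (R : realFieldType) (w : E -> R).

(* Every prefix of [es] contains at least as many elements of the greedy basis
   as of [filter p es]; the claim is the Abel summation of these
   inequalities. *)
Lemma greedy_optimal_shift (p : pred E) (mu : R) es :
  pairwise (fun e f => w f <= w e) es -> all (fun e => mu <= w e) es ->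
  free (map vec (filter p es)) ->
  \sum_(e <- filter p es) (w e - mu) <= \sum_(e <- greedy vec 0 es) (w e - mu).
Proof.
have shift s (a b : R) :
    \sum_(e <- s) (w e - b) =
    \sum_(e <- s) (w e - a) + (size s)%:R * (a - b).
  elim: s => [|x s IH]; first by rewrite !big_nil mul0r addr0.
  by rewrite !big_cons IH /= -natr1; ring.
(* Induction from the end: [w e] is the smallest weight, and with it as offset the last element
   contributes 0 to either side. Returning to the offset [mu] adds [w e - mu >= 0] per element,
   which favours the greedy basis because it is at least as long. *)
elim/last_ind: es mu => [|es e IH] mu; first by rewrite !big_nil.
rewrite pairwise_rcons all_rcons => /andP[ge_e srt] /andP[mu_e _] fr.
have frF : free (map vec (filter p es)).
  move: fr; rewrite filter_rcons; case: (p e) => //.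
  by rewrite map_rcons -cats1 => /catl_free.
have leF : (size (filter p (rcons es e)) <= size (greedy vec 0 (rcons es e)))%N.
  rewrite size_greedy_dim; move: fr; rewrite /free size_map => /eqP <-.
  exact: dim_span_filter.
have sumF : \sum_(x <- filter p (rcons es e)) (w x - w e) =
            \sum_(x <- filter p es) (w x - w e).
  rewrite filter_rcons; case: (p e) => //.
  by rewrite big_rcons /= subrr addr0.
have sumT : \sum_(x <- greedy vec 0 (rcons es e)) (w x - w e) =
            \sum_(x <- greedy vec 0 es) (w x - w e).
  rewrite -cats1 greedy_cat /= big_cat /=.
  by case: ifP => _; rewrite ?big_seq1 ?big_nil ?subrr addr0.
rewrite (shift _ (w e)) (shift _ (w e) mu) sumF sumT lerD ?IH //.
by rewrite ler_wpM2r ?subr_ge0 // ler_nat.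
Qed.

Lemma greedy_optimal (p : pred E) es :
  pairwise (fun e f => w f <= w e) es ->
  free (map vec (filter p es)) ->
  size (filter p es) = size (greedy vec 0 es) ->
  \sum_(e <- filter p es) w e <= \sum_(e <- greedy vec 0 es) w e.
Proof.
move=> srt fr eqsz.
have [mu mu_le] : exists mu, all (fun e => mu <= w e) es.
  exists (- \sum_(e <- es) `|w e|).
  elim: es {srt fr eqsz} => //= e es IH; rewrite big_cons.
  have S0 : 0 <= \sum_(e <- es) `|w e| by apply: sumr_ge0.
  have lew : - w e <= `|w e| by rewrite -normrN ler_norm.
  have e0 := normr_ge0 (w e).
  apply/andP; split; first by lra.
  by apply: sub_all IH => x /=; lra.
have := greedy_optimal_shift srt mu_le fr.
by rewrite !big_split /= !big_const_seq !count_predT eqsz lerD2r.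
Qed.

End GreedyOptimal.

(** * Forests and connectivity over F_2 *)

Section Incidence.

Variable V : finType.

Notation space := {ffun V -> ('F_2)^o}.

Implicit Types (x y : V) (A C e : {set V}) (S : seq {set V}) (X : seq space).

(* Over F_2 the incidence vector of an edge needs no orientation. *)
Definition incid A : space := [ffun z => (z \in A)%:R].
Definition unitv x : space := incid [set x].

Lemma addvv (v : space) : v + v = 0.
Proof.
by apply/ffunP => z; rewrite !ffunE; apply: addrr_pchar2; apply: pchar_Fp.
Qed.

Lemma incid2 x y : x != y -> incid [set x; y] = unitv x + unitv y.
Proof.
move=> xy; apply/ffunP => z; rewrite !ffunE !inE.
case: (eqVneq z x) => [->|]; first by rewrite (negPf xy) addr0.
by rewrite add0r.
Qed.

Lemma unitv_add_trans x y z (U : {vspace space}) :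
  unitv x + unitv y \in U -> unitv y + unitv z \in U -> unitv x + unitv z \in U.
Proof.
move=> xy yz; have := memvD xy yz.
by rewrite addrA -(addrA (unitv x)) addvv addr0.
Qed.

Lemma span_sum_eq0 A X v :
  (forall u, u \in X -> \sum_(z in A) u z = 0) ->
  v \in <<X>>%VS -> \sum_(z in A) v z = 0.
Proof.
move=> X0 /(@coord_span _ _ _ (in_tuple X)) ->.
under eq_bigr do rewrite sum_ffunE.
rewrite exchange_big big1 //= => i _.
under eq_bigr do rewrite ffunE.
rewrite -mulr_sumr X0 ?mulr0 //.
by rewrite mem_nth.
Qed.

Lemma sum_unitv A x : \sum_(z in A) unitv x z = (x \in A)%:R.
Proof.
case: (boolP (x \in A)) => xA.
  rewrite (bigD1 x) //= big1 => [|z /andP[_ zx]]; rewrite ffunE inE.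
    by rewrite eqxx addr0.
  by rewrite (negPf zx).
rewrite big1 // => z zA; rewrite ffunE inE.
by case: eqVneq => // zx; rewrite -zx zA in xA.
Qed.

(** The functional summing the coordinates over the fibre of [f x] kills every edge vector, since an
    edge has both ends or none in the fibre. On [unitv x + unitv y] it vanishes only if [y] lies in
    the fibre too. *)
Lemma span_incid_inv (T : eqType) (f : V -> T) S x y :
  (forall e, e \in S -> #|e| = 2) ->
  (forall a b, [set a; b] \in S -> f a = f b) ->
  unitv x + unitv y \in <<map incid S>>%VS -> f x = f y.
Proof.
move=> S2 fS /(@span_sum_eq0 [set z | f z == f x]).
under eq_bigr do rewrite ffunE.
rewrite big_split /= !sum_unitv !inE eqxx => H; apply/eqP; rewrite eq_sym.
case: (f y == f x) H => // H.
suff /H/eqP : forall u, u \in map incid S ->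
  \sum_(z in [set z | f z == f x]) u z = 0 by [].
move=> u /mapP[e eS ->].
have /eqP/cards2P[a [b [ab eE]]] := S2 _ eS; rewrite eE in eS *.
rewrite incid2 //.
under eq_bigr do rewrite ffunE.
rewrite big_split /= !sum_unitv !inE (fS _ _ eS).
by apply: addrr_pchar2; apply: pchar_Fp.
Qed.

Lemma adj_sym (F : {set {set V}}) : symmetric (adj F).
Proof. by move=> x y; rewrite /adj /= setUC. Qed.

(** Along a path the edge vectors telescope over F_2. Conversely, the representative [root] of a
    component is constant along edges, so [span_incid_inv] applies to it. *)
Lemma span_connect S x y :
  (forall e, e \in S -> #|e| = 2) ->
  (unitv x + unitv y \in <<map incid S>>%VS) =
  connect (adj [set e in S]) x y.
Proof.
move=> S2; apply/idP/idP => [|/connectP[p]].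
  have sym : connect_sym (adj [set e in S]).
    exact/sym_connect_sym/adj_sym.
  rewrite -(root_connect sym) => xy; apply/eqP.
  apply: span_incid_inv xy => // a b abS.
  by apply/eqP; rewrite root_connect // connect1 // /adj /= inE.
elim: p x => [|z p IH] x /= => [_ ->|/andP[]]; first by rewrite addvv mem0v.
rewrite /adj /= inE => xzS /IH{}IH /IH; apply: unitv_add_trans.
rewrite -incid2; first by rewrite memv_span // map_f.
by have := S2 _ xzS; rewrite cards2; case: eqP.
Qed.

Lemma free_unitv (s : seq V) : uniq s -> free (map unitv s).
Proof.
elim: s => [|x s IH]; first by rewrite nil_free.
move=> /= /andP[xs /IH fr]; rewrite free_cons fr andbT.
apply/negP => /(@span_sum_eq0 [set x]).
rewrite sum_unitv inE eqxx => H.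
suff /H/eqP : forall u, u \in map unitv s -> \sum_(z in [set x]) u z = 0 by [].
move=> u /mapP[z zs ->].
by rewrite sum_unitv inE; case: eqVneq => // zx; rewrite -zx zs in xs.
Qed.

(** Adjoining a single [unitv x0] to the span yields every unit vector of [C], and these are
    independent. *)
Lemma card_le_dim_connected S C :
  (forall x y, x \in C -> y \in C -> unitv x + unitv y \in <<map incid S>>%VS) ->
  (#|C| <= (\dim <<map incid S>>).+1)%N.
Proof.
move=> conn; case: (set_0Vmem C) => [->|[x0 x0C]]; first by rewrite cards0.
have sub : (<<map unitv (enum C)>> <= <<map incid S>> + <[unitv x0]>)%VS.
  apply/span_subvP => v /mapP[x]; rewrite mem_enum => xC ->.
  have -> : unitv x = (unitv x + unitv x0) + unitv x0 by rewrite -addrA addvv addr0.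
  by rewrite memv_add ?conn ?memv_line.
have := dimvS sub.
have /eqP -> := free_unitv (enum_uniq C); rewrite size_map -cardE => le.
apply: leq_trans le _; apply: leq_trans (dimv_add_leqif _ _) _.
by rewrite dim_vline; case: eqP; rewrite ?addn0 ?addn1.
Qed.

(** For [x0] in [C], the edges of a star with centre [x0], a reference spanning tree whose span
    contains the vectors of all edges inside [C]. *)
Definition star C x0 : seq space := [seq unitv x + unitv x0 | x <- enum (C :\ x0)].

Lemma unitv_add_star C x0 x y :
  x \in C -> y \in C -> unitv x + unitv y \in <<star C x0>>%VS.
Proof.
have base z : z \in C -> unitv z + unitv x0 \in <<star C x0>>%VS.
  move=> zC; case: (eqVneq z x0) => [->|zx]; first by rewrite addvv mem0v.
  by apply: memv_span; apply/mapP; exists z; rewrite // mem_enum !inE zx.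
move=> /base xC /base yC; apply: unitv_add_trans xC _.
by rewrite addrC.
Qed.

Lemma span_incid_star S C x0 :
  (forall e, e \in S -> #|e| = 2 /\ e \subset C) ->
  (<<map incid S>> <= <<star C x0>>)%VS.
Proof.
move=> SP; apply/span_subvP => v /mapP[e eS ->].
have [/eqP/cards2P[a [b [ab ->]]]] := SP _ eS.
by rewrite subUset !sub1set incid2 // => /andP[aC bC]; apply: unitv_add_star.
Qed.

Lemma dim_incid_le S C :
  (forall e, e \in S -> #|e| = 2 /\ e \subset C) ->
  (\dim <<map incid S>> <= #|C|.-1)%N.
Proof.
move=> SP; case: (set_0Vmem C) => [C0|[x0 x0C]].
  (* No edge fits into an empty [C], so [S] is empty and the truncated predecessor of 0 does no
     harm. *)
  case: S SP => [|e S SP]; first by rewrite span_nil dimv0.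
  have [e2] := SP e (mem_head _ _).
  by rewrite C0 subset0 => /eqP e0; rewrite e0 cards0 in e2.
apply: leq_trans (dimvS (span_incid_star x0 SP)) _.
apply: leq_trans (dim_span _) _.
by rewrite size_map -cardE (cardsD1 x0 C) x0C.
Qed.

(** The span of [S] lies in that of a star and has at least the same dimension, so the two
    coincide. *)
Lemma free_incid_connected S C x y :
  free (map incid S) -> (forall e, e \in S -> #|e| = 2 /\ e \subset C) ->
  (#|C| <= (size S).+1)%N -> x \in C -> y \in C ->
  unitv x + unitv y \in <<map incid S>>%VS.
Proof.
move=> /eqP fr SP le xC yC; rewrite size_map in fr.
have /eqP -> : (<<map incid S>> == <<star C x>>)%VS.
  rewrite eqEdim (span_incid_star x SP) fr.
  apply: leq_trans (dim_span _) _.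
  by rewrite size_map -cardE; move: le; rewrite (cardsD1 x C) xC.
exact: unitv_add_star.
Qed.

End Incidence.

Arguments incid {V} A.
Arguments unitv {V} x.

(** * Disjoint-set forests and the greedy forest *)

Section DisjointSets.

Variables (R : realFieldType) (V : finType).

Implicit Types (d : dsf V) (x y z a b : V) (rt : V -> V) (h : V -> nat).

(** [rt] and [h] are ghost data: the root of each vertex, and a height that drops along parent
    pointers and so bounds the length of a search. [height_card] is the union-by-size invariant. *)
Record dsf_spec d rt h : Prop := DsfSpec {
  parent_rt : forall x, parent d (rt x) = rt x;
  rt_fix : forall x, parent d x = x -> rt x = x /\ h x = 0%N;
  rt_parent : forall x, rt (parent d x) = rt x;
  height_parent : forall x, parent d x <> x -> (h (parent d x) < h x)%N;
  height_card : forall x, (2 ^ h x <= card_of d (rt x))%N;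
  card_rt : forall x, card_of d (rt x) = #|[set z | rt z == rt x]|
}.

Lemma new_dsf_spec : dsf_spec (Dsf id (fun=> 1%N)) id (fun=> 0%N).
Proof.
split=> //= x.
by rewrite -(cards1 x); congr #|pred_of_set _|; apply/setP => z; rewrite !inE.
Qed.

Section Spec.

Variables (d : dsf V) (rt : V -> V) (h : V -> nat).
Hypothesis dP : dsf_spec d rt h.

Lemma rt_idem x : rt (rt x) = rt x.
Proof. by have [] := rt_fix dP (parent_rt dP x). Qed.

Lemma height_log x : (h x <= trunc_log 2 #|V|)%N.
Proof.
apply: trunc_log_max => //; apply: leq_trans (height_card dP x) _.
by rewrite (card_rt dP) max_card.
Qed.

(** Justifies the fuel [#|V|] given to [findT]. *)
Lemma height_lt_card x : (h x <= #|V|)%N.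
Proof.
apply: leq_trans (height_log x) _.
case: (posnP #|V|) => [->|n0]; first by rewrite trunc_log0.
exact/ltnW/(leq_trans (ltn_expl _ (ltnSn 1)))/trunc_logP.
Qed.

Lemma findT_spec fuel x :
  (h x <= fuel)%N ->
  result (findT d fuel x) = rt x /\ (cost (findT d fuel x) <= (h x).+1)%N.
Proof.
elim: fuel x => [|fuel IH] x hx /=; case: eqP => px.
- by have [-> _] := rt_fix dP px.
- by have := height_parent dP px; rewrite ltnNge (leq_trans hx).
- by have [-> _] := rt_fix dP px.
have lt := height_parent dP px.
have [] := IH (parent d x); first by rewrite -ltnS (leq_trans lt).
rewrite /result /cost /= (rt_parent dP) => -> le; split=> //.
by rewrite add1n ltnS (leq_trans le).
Qed.

Lemma find_rt x : result (findT d #|V| x) = rt x.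
Proof. by case: (findT_spec (height_lt_card x)). Qed.

Lemma cost_findT x : (cost (findT d #|V| x) <= (trunc_log 2 #|V|).+1)%N.
Proof.
case: (findT_spec (height_lt_card x)) => _ le; apply: leq_trans le _.
by rewrite ltnS height_log.
Qed.

Definition merge_rt a b z := if rt z == a then b else rt z.

Lemma link_root_spec a b :
  rt a = a -> rt b = b -> a != b -> (card_of d a <= card_of d b)%N ->
  exists h',
    dsf_spec (Dsf (write (parent d) a b)
                  (write (card_of d) b (card_of d a + card_of d b)))
             (merge_rt a b) h'.
Proof.
(* Hanging [a] below [b] moves exactly the vertices of the tree of [a] one level down. *)
move=> ra rb ab le; exists (fun z => if rt z == a then (h z).+1 else h z).
have pa : parent d a = a by rewrite -{1}ra (parent_rt dP).
have pb : parent d b = b by rewrite -{1}rb (parent_rt dP).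
have ba : b == a = false by rewrite eq_sym (negPf ab).
have hb : h b = 0%N by case: (rt_fix dP pb).
split=> x; rewrite /merge_rt /=.
- rewrite /write; case: (eqVneq (rt x) a) => [_|xa]; first by rewrite ba.
  rewrite (negPf xa).
  by rewrite (parent_rt dP).
- rewrite /write; case: (eqVneq x a) => [->|xa].
    by move=> e; rewrite e eqxx in ab.
  by move=> px; have [-> ->] := rt_fix dP px; rewrite (negPf xa).
- rewrite /write; case: (eqVneq x a) => [->|xa].
    by rewrite rb ba ra eqxx.
  by rewrite (rt_parent dP).
- rewrite /write; case: (eqVneq x a) => [->|xa].
    by rewrite rb ba ra eqxx hb.
  by move=> px; rewrite (rt_parent dP); case: ifP => _; rewrite ?ltnS (height_parent dP).
(* A vertex that gains a level finds its tree at least doubled, because the tree of [a] is not the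
   larger one. *)
- have := height_card dP x; rewrite /write.
  case: (eqVneq (rt x) a) => [-> |_] hx.
    by rewrite eqxx expnS mul2n -addnn leq_add // (leq_trans hx).
  case: eqP hx => // -> hx; exact: leq_trans hx (leq_addl _ _).
have cardab : #|[set z | (if rt z == a then b else rt z) == b]| =
              (card_of d a + card_of d b)%N.
  have cardE r : rt r = r -> card_of d r = #|[set z | rt z == r]|.
    by move=> rr; rewrite -{1}rr (card_rt dP) rr.
  rewrite !cardE // -cardsUI.
  rewrite [X in (_ + X)%N](_ : _ = 0%N) ?addn0; last first.
    apply/eqP; rewrite cards_eq0; apply/eqP/setP => z; rewrite !inE.
    by case: eqVneq => // ->; rewrite (negPf ab).
  congr #|pred_of_set _|; apply/setP => z; rewrite !inE.
  by case: (eqVneq (rt z) a) => // _; rewrite eqxx.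
rewrite /write; case: (eqVneq (rt x) a) => [_|xa].
  by rewrite eqxx cardab.
case: (eqVneq (rt x) b) => [->|xb]; first by rewrite cardab.
rewrite (card_rt dP); congr #|pred_of_set _|; apply/setP => z; rewrite !inE.
case: (eqVneq (rt z) a) => // ->.
by rewrite (eq_sym a) (negPf xa) (eq_sym b) (negPf xb).
Qed.

(** Which root survives depends on the sizes, but the resulting partition does not; hence the
    description by equality of roots. *)
Lemma link_spec x y :
  rt x != rt y ->
  exists rt' h', dsf_spec (link d (rt x) (rt y)) rt' h' /\
    forall u v, (rt' u == rt' v) =
      [|| rt u == rt v, (rt u == rt x) && (rt v == rt y)
        | (rt u == rt y) && (rt v == rt x)].
Proof.
have merge_rtE a b u v : a != b ->
    (merge_rt a b u == merge_rt a b v) =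
      [|| rt u == rt v, (rt u == a) && (rt v == b)
        | (rt u == b) && (rt v == a)].
  rewrite /merge_rt => ab.
  case: (eqVneq (rt u) a) => [->|ua]; case: (eqVneq (rt v) a) => [->|va].
  - by rewrite !eqxx.
  - by rewrite eq_sym andbF orbF.
  - by rewrite (negPf ua) andbT.
  - by rewrite andbF /= orbF.
move=> xy; rewrite /link; case: ltnP => lexy.
  have [h' H] := link_root_spec (rt_idem x) (rt_idem y) xy (ltnW lexy).
  exists (merge_rt (rt x) (rt y)), h'; split=> // u v.
  exact: merge_rtE.
have yx : rt y != rt x by rewrite eq_sym.
have [h' H] := link_root_spec (rt_idem y) (rt_idem x) yx lexy.
exists (merge_rt (rt y) (rt x)), h'; rewrite addnC; split=> // u v.
by rewrite merge_rtE // [X in _ || X]orbC.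
Qed.

End Spec.

Definition edge_vec (e : edge R V) := incid (ends e).

(** [S] holds the edges selected so far. The invariant equates sharing a root with membership in
    their span, so comparing two roots is the membership test of [greedy]. *)
Lemma greedyT_spec d rt h (S : seq {set V}) es :
  dsf_spec d rt h -> (forall e, e \in S -> #|e| = 2) ->
  (forall x y, (rt x == rt y) = (unitv x + unitv y \in <<map incid S>>%VS)) ->
  all (fun e => src e != dst e) es ->
  result (greedyT d es) = greedy edge_vec <<map incid S>> es /\
  (cost (greedyT d es) <= size es * (2 * trunc_log 2 #|V| + 3) + 1)%N.
Proof.
(* An edge costs one step and two searches of at most [l + 1] steps each, which gives
   [2 * l + 3]. *)
have arith (a b c k l : nat) : (a <= l.+1 -> b <= l.+1 -> c <= k * (2 * l + 3) + 1 ->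
    1 + (a + (b + c)) <= k.+1 * (2 * l + 3) + 1)%N.
  by rewrite mulSn; lia.
elim: es d rt h S => [|e es IH] d rt h S dP S2 rtS //= /andP[ne nes].
rewrite /result /cost /bind /tick /charge /=.
have cx := cost_findT dP (src e); have cy := cost_findT dP (dst e).
have := find_rt dP (src e); have := find_rt dP (dst e).
rewrite /result /cost in cx cy * => -> ->.
rewrite {1}/edge_vec /ends incid2 // -rtS; case: eqP => [eqr|/eqP neqr].
  have [] := IH _ _ _ _ dP S2 rtS nes; rewrite /result /cost => -> le; split=> //.
  exact: arith.
have [rt' [h' [dP' rtE]]] := link_spec dP neqr.
have S2' f : f \in ends e :: S -> #|f| = 2.
  by rewrite inE => /orP[/eqP->|/S2 //]; rewrite cards2 ne.
have rtS' x y :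
    (rt' x == rt' y) = (unitv x + unitv y \in <<map incid (ends e :: S)>>%VS).
  have mem_e : unitv (src e) + unitv (dst e) \in <<map incid (ends e :: S)>>%VS.
    by rewrite -incid2 //; apply/memv_span/map_f/mem_head.
  have mem_rt u v :
      rt u = rt v -> unitv u + unitv v \in <<map incid (ends e :: S)>>%VS.
    move/eqP; rewrite rtS; apply/subvP/sub_span => f fS.
    by rewrite /= inE fS orbT.
  apply/idP/idP.
    rewrite rtE => /or3P[/eqP/mem_rt //|/andP[/eqP xe /eqP ye]|/andP[/eqP xe /eqP ye]].
      apply: unitv_add_trans (mem_rt _ _ xe) (unitv_add_trans mem_e _).
      exact: mem_rt.
    have mem_e' : unitv (dst e) + unitv (src e) \in <<map incid (ends e :: S)>>%VS.
      by rewrite addrC.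
    apply: unitv_add_trans (mem_rt _ _ xe) (unitv_add_trans mem_e' _).
    exact: mem_rt.
  (* Conversely, [rt'] is constant on every edge of [S] and on the new edge, so it can serve as the
     invariant [f]. *)
  move=> xy; apply/eqP; apply: span_incid_inv xy => // a b.
  rewrite inE => /orP[/eqP abe|abS]; apply/eqP; last first.
    rewrite rtE rtS -incid2 ?memv_span ?map_f //.
    by have := S2 _ abS; rewrite cards2; case: eqP.
  have : (a \in ends e) && (b \in ends e) by rewrite -abe !inE !eqxx orbT.
  by rewrite rtE !inE => /andP[/orP[]/eqP-> /orP[]/eqP->]; rewrite !eqxx ?orbT.
have [] := IH _ _ _ _ dP' S2' rtS' nes.
rewrite /result /cost /= => -> le; split; last first.
  by rewrite addn0; apply: arith.
by rewrite /edge_vec /ends span_cons addvC.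
Qed.

Lemma greedy_forestT_spec es :
  all (fun e => src e != dst e) es ->
  result (greedy_forestT es) = greedy edge_vec 0 es /\
  (cost (greedy_forestT es) <=
     2 * #|V| + size es * (2 * trunc_log 2 #|V| + 3) + 1)%N.
Proof.
move=> nes.
have [] := @greedyT_spec _ _ _ [::] es new_dsf_spec _ _ nes => //.
  move=> x y; rewrite span_nil memv0; apply/eqP/eqP => [->|]; first exact: addvv.
  by move/ffunP/(_ x); rewrite !ffunE !inE eqxx; case: (eqVneq x y).
rewrite [map _ _]/= span_nil /greedy_forestT /result /cost /= => -> le; split=> //.
by rewrite addn0 mul2n -addnn -[leqRHS]addnA leq_add2l.
Qed.

End DisjointSets.

(** * Results and costs of the list programs *)

Section TimedLists.

Variables A B : Type.

Lemma countT_spec (p : pred A) s :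
  result (countT p s) = count p s /\ cost (countT p s) = (size s).+1.
Proof.
elim: s => [|x s [IHr IHc]] //; rewrite /result /cost /= in IHr IHc *.
by rewrite IHr IHc add1n addn0.
Qed.

Lemma foldT_spec (f : A -> B -> B) b s :
  result (foldT f b s) = foldr f b s /\ cost (foldT f b s) = (size s).+1.
Proof.
elim: s => [|x s [IHr IHc]] //; rewrite /result /cost /= in IHr IHc *.
by rewrite IHr IHc add1n addn0.
Qed.

Lemma mapT_spec (f : A -> timed B) k s :
  (forall x, cost (f x) = k) ->
  result (mapT f s) = map (fun x => result (f x)) s /\
  cost (mapT f s) = (size s * k.+1).+1.
Proof.
move=> fk; elim: s => [|x s [IHr IHc]] //; rewrite /result /cost /= in IHr IHc *.
by rewrite IHr IHc; split=> //; have := fk x; rewrite /cost => ->; rewrite mulSn; lia.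
Qed.

Lemma result_allT (p : A -> timed bool) s :
  result (allT p s) = all (fun x => result (p x)) s.
Proof.
elim: s => //= x s; rewrite /result /= => <-.
by case: (p x) => k [].
Qed.

Lemma cost_allT (p : A -> timed bool) k s :
  (forall x, cost (p x) <= k)%N -> (cost (allT p s) <= (size s * k.+1).+1)%N.
Proof.
move=> pk; elim: s => //= x s; rewrite /cost /= => IH.
have := pk x; rewrite /cost; case: (p x) => j [] /=; rewrite mulSn; lia.
Qed.

End TimedLists.

(** * Merge sort *)

Section MergeSort.

Variables (A : Type) (le : rel A).
Hypothesis le_total : total le.

Definition total_size (ss : seq (seq A)) := sumn (map size ss).

Lemma mergeT_spec s1 s2 :
  result (mergeT le s1 s2) = merge le s1 s2 /\
  (cost (mergeT le s1 s2) <= size s1 + size s2 + 1)%N.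
Proof.
elim: s1 s2 => [|x1 s1 IH1]; first by case.
elim=> [|x2 s2 [IHr IHc]]; first by split=> //=; rewrite /cost /=; lia.
rewrite [mergeT _ _ _]/= [merge _ _ _]/=; case: ifP => _.
  have [] := IH1 (x2 :: s2); rewrite /result /cost /= => -> c; split=> //; lia.
move: IHr IHc; rewrite /result /cost /= => -> c; split=> //; lia.
Qed.

Lemma merge_pairsT_cost ss :
  (cost (merge_pairsT le ss) <= total_size ss + size ss + 1)%N.
Proof.
elim/ltn_ind: (size ss) {-2}ss (erefl (size ss)) => n IH {}ss.
case: ss => [|s1 [|s2 ss]] szE; rewrite /cost /total_size /=; try lia.
have [_] := mergeT_spec s1 s2.
have := IH (size ss) _ ss erefl; rewrite -szE /= => /(_ (leqnSn _)).
rewrite /cost /total_size; lia.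
Qed.

(** Since [A] carries no decidable equality, being a permutation is expressed by the counts of all
    predicates. *)
Lemma merge_pairsT_spec ss :
  [/\ (size (result (merge_pairsT le ss))).*2 <= (size ss).+1,
      total_size (result (merge_pairsT le ss)) = total_size ss,
      forall p, count p (flatten (result (merge_pairsT le ss))) =
                count p (flatten ss) &
      all (sorted le) ss -> all (sorted le) (result (merge_pairsT le ss))]%N.
Proof.
elim/ltn_ind: (size ss) {-2}ss (erefl (size ss)) => n IH {}ss.
case: ss => [|s1 [|s2 ss]] szE //.
have [] := IH (size ss) _ ss erefl; first by rewrite -szE /= leqnSn.
have [rE _] := mergeT_spec s1 s2.
rewrite /result /total_size /= in rE * => szr totr cntr srtr; rewrite rE; split.
- by rewrite doubleS !ltnS.
- by rewrite totr size_merge size_cat addnA.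
- by move=> p; rewrite !count_cat cntr count_merge count_cat addnA.
- by case/and3P=> ? ? /srtr ->; rewrite merge_sorted.
Qed.

(** A round halves the number of lists, rounding up, so at most [j] rounds occur. Each costs one
    step besides [merge_pairsT] and keeps the total size. *)
Lemma merge_allT_cost fuel ss j :
  (size ss <= 2 ^ j)%N ->
  (cost (merge_allT le fuel ss) <= 1 + j * (total_size ss + size ss + 2))%N.
Proof.
elim: j fuel ss => [|j IH] fuel [|s1 [|s2 ss]] // szj; try by case: fuel.
case: fuel => [|fuel] //.
have := merge_pairsT_cost (s1 :: s2 :: ss).
have [] := merge_pairsT_spec (s1 :: s2 :: ss).
have -> : cost (merge_allT le fuel.+1 (s1 :: s2 :: ss)) =
    (1 + (cost (merge_pairsT le (s1 :: s2 :: ss)) +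
          cost (merge_allT le fuel (result (merge_pairsT le (s1 :: s2 :: ss))))))%N.
  by [].
move: szj; rewrite expnS mul2n.
have : (2 <= size (s1 :: s2 :: ss))%N by [].
move: (s1 :: s2 :: ss) => tt k2 szj szr totr _ _ mc.
have := IH fuel (result (merge_pairsT le tt)); rewrite totr.
move: (cost (merge_allT _ _ _)) => c2 /(_ ltac:(lia)) IHr.
have : (j * (total_size tt + size (result (merge_pairsT le tt)) + 2) <=
        j * (total_size tt + size tt + 2))%N by rewrite leq_mul2l; lia.
by rewrite mulSn; lia.
Qed.

Lemma merge_allT_spec fuel ss :
  (size ss <= 2 ^ fuel)%N -> all (sorted le) ss ->
  sorted le (result (merge_allT le fuel ss)) /\
  forall p, count p (result (merge_allT le fuel ss)) = count p (flatten ss).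
Proof.
elim: fuel ss => [|fuel IH] [|s1 [|s2 ss]] // szj srt.
- by split; [case/andP: srt | move=> p; rewrite /= cats0].
- by split; [case/andP: srt | move=> p; rewrite /= cats0].
have [szr _ cntr /(_ srt) srtr] := merge_pairsT_spec (s1 :: s2 :: ss).
have [|IHs IHc] := IH _ _ srtr.
  by move: szr szj; rewrite expnS mul2n; set k := size (result _); lia.
rewrite [merge_allT _ _ _]/=; split=> [|p]; first exact: IHs.
by rewrite -cntr -IHc.
Qed.

Lemma sortT_spec s :
  [/\ sorted le (result (sortT le s)),
      forall p, count p (result (sortT le s)) = count p s &
      forall j, (size s <= 2 ^ j)%N ->
        (cost (sortT le s) <= size s + 2 + j * (2 * size s + 2))%N].
Proof.
have [mr mc] := @mapT_spec A (seq A) (fun x => ret [:: x]) 0 s (fun=> erefl).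
have sz : size (result (mapT (fun x => ret [:: x]) s)) = size s.
  by rewrite mr size_map.
have tot : total_size (map (fun x => [:: x]) s) = size s.
  by rewrite /total_size; elim: s {mr mc sz} => //= x s ->; rewrite add1n.
have flt : flatten (map (fun x => [:: x]) s) = s by elim: (s) => //= x t ->.
have [||srt cnt] := @merge_allT_spec (size s) (map (fun x => [:: x]) s).
- by rewrite size_map ltnW // ltn_expl.
- by elim: (s).
move: mr mc; rewrite /sortT /cost /result /= => mr mc; rewrite mr mc muln1.
split=> //; first by move=> p; rewrite -[in RHS]flt -cnt.
move=> j szj; have := @merge_allT_cost (size s) (map (fun x => [:: x]) s) j.
rewrite tot size_map /cost => /(_ szj).
have -> : (size s + size s + 2 = 2 * size s + 2)%N by lia.
lia.
Qed.

End MergeSort.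

(** * Comparison of solutions with the greedy tree *)

Section Correctness.

Variables (R : realFieldType) (V : finType) (I : cnws R V).

Implicit Types (F : {set {set V}}) (C : {set V}) (T : seq {set V}).

Definition comm_edges C T := count (fun e : {set V} => e \subset C) T.

(** Consecutive communities share a vertex and each is connected by [F], so walks through the
    communities can be concatenated. *)
Lemma solution_connects F x y :
  hypergraph_connected (comms I) -> solution I F -> connect (adj F) x y.
Proof.
move=> hyp [_ _ _ conn].
have connC C u v : C \in comms I -> u \in C -> v \in C -> connect (adj F) u v.
  move=> Cc uC vC; apply: connect_sub (conn C Cc u v uC vC) => a b.
  by rewrite /adj /= inE => /andP[abF _]; apply: connect1.
case: (eqVneq x y) => [->|/hyp[C [s [sub pth xC yl]]]]; first exact: connect0.
elim: s C x sub pth xC yl => [|D s IH] C x sub /= pth xC yl.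
  by apply: (connC C) => //; apply: sub; rewrite mem_head.
case/andP: pth => /set0Pn[z]; rewrite inE => /andP[zC zD] pth.
apply: (@connect_trans _ _ z); first by apply: (connC C) => //; apply: sub; rewrite mem_head.
by apply: IH pth zD yl => E Es; apply: sub; rewrite inE Es orbT.
Qed.

Lemma connected_card_le C T :
  (forall e, e \in T -> #|e| = 2) -> connected_graph C [set e in T] ->
  (#|C| <= (\dim <<map incid T>>).+1)%N.
Proof.
move=> T2 conn; apply: card_le_dim_connected => x y xC yC.
by rewrite span_connect //; apply: conn.
Qed.

Lemma card_comm_edges F C :
  comm_edges C (enum F) = size (enum (induced_edges F C)).
Proof.
rewrite -cardE /comm_edges -size_filter cardE.
apply/perm_size/uniq_perm => [||e]; [exact/filter_uniq/enum_uniq|exact: enum_uniq|].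
by rewrite mem_filter !mem_enum inE andbC.
Qed.

Lemma solution_comm_edges F C :
  solution I F -> C \in comms I -> (#|C| <= (comm_edges C (enum F)).+1)%N.
Proof.
case=> /subsetP sub _ _ conn Cc; rewrite card_comm_edges.
apply: leq_trans (connected_card_le (T := enum (induced_edges F C)) _ _) _.
- move=> e; rewrite mem_enum inE => /andP[/sub eI _].
  exact: edges_card2 eI.
- by rewrite set_enum; apply: conn.
by rewrite ltnS -(size_map incid) dim_span.
Qed.

Lemma free_comm_edges C T :
  (forall e, e \in T -> #|e| = 2) -> free (map incid T) ->
  (comm_edges C T <= #|C|.-1)%N.
Proof.
move=> T2 /(@free_map_filter _ _ _ _ (fun e : {set V} => e \subset C)) /eqP.
rewrite /comm_edges size_map size_filter => <-; apply: dim_incid_le => e.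
by rewrite mem_filter => /andP[eC /T2].
Qed.

Definition multiplicity (e : {set V}) :=
  count (fun C : {set V} => e \subset C) (comms I).

(** Double counting of the pairs of an edge of [T] and a community containing it. *)
Lemma sum_multiplicity T :
  (\sum_(e <- T) multiplicity e = \sum_(C <- comms I) comm_edges C T)%N.
Proof.
under eq_bigr do rewrite /multiplicity -sum1_count big_mkcond.
rewrite exchange_big; apply: eq_bigr => C _.
by rewrite /comm_edges -sum1_count [RHS]big_mkcond.
Qed.

(** Turns a comparison of totals over all communities into equality at each one: a single strict
    inequality would make the sum of [a] too small. *)
Lemma eq_sum_leq (A : eqType) (a b : A -> nat) (s : seq A) :
  (forall x, x \in s -> a x <= b x)%N ->
  (\sum_(x <- s) b x <= \sum_(x <- s) a x)%N ->
  forall x, x \in s -> a x = b x.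
Proof.
elim: s => // y s IH ab; rewrite !big_cons => le x.
have aby := ab y (mem_head _ _).
have abs z : z \in s -> (a z <= b z)%N by move=> zs; apply: ab; rewrite inE zs orbT.
have les : (\sum_(x <- s) a x <= \sum_(x <- s) b x)%N.
  by rewrite !big_seq; apply: leq_sum.
rewrite inE => /orP[/eqP->|xs]; first by move: aby le les; lia.
by apply: IH xs => //; move: aby le les; lia.
Qed.

Variable es : seq {set V}.
Hypothesis esP : perm_eq es (enum (edges I)).
Hypothesis ellE : ell I = #|V|%:Z - 1.
Hypothesis hyp : hypergraph_connected (comms I).

Let T := greedy incid 0 es.

Lemma mem_es e : (e \in es) = (e \in edges I).
Proof. by rewrite (perm_mem esP) mem_enum. Qed.

Lemma es_card2 e : e \in es -> #|e| = 2.
Proof. by rewrite mem_es; apply: edges_card2. Qed.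

Lemma es_uniq : uniq es.
Proof. by rewrite (perm_uniq esP) enum_uniq. Qed.

Lemma T_card2 e : e \in T -> #|e| = 2.
Proof. by move/(mem_subseq (greedy_subseq _ _ _))/es_card2. Qed.

Lemma dim_edges_le : (\dim <<map incid es>> <= #|V|.-1)%N.
Proof.
by rewrite -cardsT; apply: dim_incid_le => e /es_card2 ->; rewrite subsetT.
Qed.

(** [T] is a forest, so [#|C| - 1] of its edges inside [C] already connect [C]; the counting test of
    the algorithm thus certifies a solution. *)
Lemma kruskal_solution :
  (size T)%:Z <= ell I -> \sum_(e <- T) omega I e <= budget I ->
  (forall C, C \in comms I -> (#|C| <= (comm_edges C T).+1)%N) ->
  solution I [set e in T] /\ weight I [set e in T] = \sum_(e <- T) omega I e.
Proof.
move=> szT wT commT.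
have subT := greedy_subseq incid 0 es; rewrite -/T in subT.
have uT : uniq T by apply: subseq_uniq subT es_uniq.
have wE : weight I [set e in T] = \sum_(e <- T) omega I e.
  by rewrite /weight (big_uniq _ uT); apply: eq_bigl => e; rewrite inE.
split=> //; split; rewrite ?wE //.
- by apply/subsetP => e; rewrite inE => /(mem_subseq subT); rewrite mem_es.
- by rewrite cardsE (card_uniqP uT).
move=> C /commT leC x y xC yC.
have -> : induced_edges [set e in T] C =
          [set e in filter (fun e : {set V} => e \subset C) T].
  by apply/setP => e; rewrite !inE mem_filter andbC.
rewrite -span_connect; last by move=> e; rewrite mem_filter => /andP[_ /T_card2].
apply: free_incid_connected xC yC; last by rewrite size_filter.
- by apply: free_map_filter; apply: free_greedy.
- by move=> e; rewrite mem_filter => /andP[eC /T_card2].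
Qed.

Section Optimality.

Variable F : {set {set V}}.
Hypothesis FP : solution I F.

(** The edges of [F] in the order of [es], the form in which [greedy_optimal] compares a family with
    the greedy one. *)
Let Fs := filter (fun e => e \in F) es.

Lemma perm_Fs : perm_eq Fs (enum F).
Proof.
apply: uniq_perm => [||e]; [exact/filter_uniq/es_uniq|exact: enum_uniq|].
rewrite mem_filter mem_enum mem_es; case: (boolP (e \in F)) => //= eF.
by case: FP => /subsetP ->.
Qed.

(** A squeeze: connecting all vertices takes dimension at least [#|V| - 1], the limit [ell I] leaves
    at most [#|V| - 1] edges, and all of [es] spans dimension at most [#|V| - 1]. *)
Lemma solution_spanning_tree :
  [/\ (0 < #|V|)%N, size Fs = #|V|.-1, free (map incid Fs) &
      \dim <<map incid es>> = #|V|.-1].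
Proof.
have szF : size Fs = #|F| by rewrite (perm_size perm_Fs) cardE.
have leF : (#|F| < #|V|)%N.
  (* For an empty [V] the integer [ell I] would be -1, so the existence of a solution also forces
     [V] to be nonempty. *)
  by case: FP => _; rewrite ellE => H _ _; move: H; lia.
have cardV : (#|V| <= (\dim <<map incid Fs>>).+1)%N.
  rewrite -cardsT; apply: connected_card_le => [e|x y _ _].
    by rewrite mem_filter => /andP[_ /es_card2].
  have -> : [set e in Fs] = F.
    by apply/setP => e; rewrite inE (perm_mem perm_Fs) mem_enum.
  exact: solution_connects.
have dimF := dim_span (map incid Fs); rewrite size_map in dimF.
have dimE := dim_edges_le.
have dimFE := dim_span_filter incid (fun e => e \in F) es.
rewrite -/Fs in dimFE.
rewrite /free size_map -szF in leF *.
move: (\dim <<map incid Fs>>) (\dim <<map incid es>>) (size Fs) #|V|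
  leF cardV dimF dimE dimFE => dF dE k n *.
by split; lia.
Qed.

Variable X : R.
Hypothesis omega_lt : forall e, e \in edges I -> omega I e < X.

Definition tilde_omega e := (multiplicity e)%:R + (X - omega I e) / X.

Hypothesis es_sorted : pairwise (fun e f => tilde_omega f <= tilde_omega e) es.

Lemma X_gt0 e : e \in edges I -> 0 < X.
Proof. by move=> eI; apply: le_lt_trans (omega_ge0 eI) (omega_lt eI). Qed.

(* The fractional part of [tilde_omega] lies in ]0, 1], so the edges are
   ordered lexicographically, first by multiplicity. *)
Lemma multiplicity_sorted :
  pairwise (fun e f => (multiplicity f)%:R <= (multiplicity e)%:R :> R) es.
Proof.
apply: (sub_in_pairwise (P := mem es)) es_sorted; last exact/allP.
move=> e f /=; rewrite !mem_es => eI fI; rewrite /tilde_omega ler_nat => le.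
rewrite leqNgt; apply/negP; rewrite -(ler_nat R) -natr1 => lt.
have X0 := X_gt0 eI.
have f0 : 0 < (X - omega I f) / X by rewrite divr_gt0 // subr_gt0 omega_lt.
have e1 : (X - omega I e) / X <= 1.
  by rewrite ler_pdivrMr // mul1r lerBlDr lerDl omega_ge0.
lra.
Qed.

(** With multiplicity and size fixed and [X] positive, a larger [tilde_omega] means a smaller
    [omega]. *)
Lemma sum_tilde_omega (s : seq {set V}) : X != 0 ->
  \sum_(e <- s) tilde_omega e =
  (\sum_(e <- s) multiplicity e)%:R + (size s)%:R - (\sum_(e <- s) omega I e) / X.
Proof.
move=> X0; elim: s => [|e s IH]; first by rewrite !big_nil /= mul0r !addr0 subr0.
by rewrite !big_cons IH /= /tilde_omega natrD -natr1; field.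
Qed.

(** In each community [T] has at most [#|C| - 1] edges and [F] at least that many, while optimality
    for [multiplicity] gives the reverse inequality in total. All of these are therefore
    equalities. *)
Lemma kruskal_beats_solution :
  [/\ (size T)%:Z <= ell I,
      \sum_(e <- T) omega I e <= weight I F &
      forall C, C \in comms I -> (#|C| <= (comm_edges C T).+1)%N].
Proof.
have [n0 szF freeF dimE] := solution_spanning_tree.
have szT : size T = #|V|.-1 by rewrite /T size_greedy_dim.
have sumF (f : {set V} -> R) : \sum_(e <- Fs) f e = \sum_(e in F) f e.
  by rewrite (perm_big _ perm_Fs) big_enum.
have zopt := greedy_optimal multiplicity_sorted freeF (etrans szF (esym szT)).
have topt := greedy_optimal es_sorted freeF (etrans szF (esym szT)).
rewrite -/T -!natr_sum ler_nat !sum_multiplicity in zopt.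
have leT C : C \in comms I -> (comm_edges C T <= #|C|.-1)%N.
  by move=> _; apply: free_comm_edges T_card2 _; apply: free_greedy.
have leF C : C \in comms I -> (#|C|.-1 <= comm_edges C Fs)%N.
  move=> /(solution_comm_edges FP).
  by rewrite /comm_edges (permP perm_Fs); case: #|C|.
have leFT : (\sum_(C <- comms I) #|C|.-1 <= \sum_(C <- comms I) comm_edges C T)%N.
  by apply: leq_trans zopt; rewrite !big_seq; apply: leq_sum.
have eqT := eq_sum_leq leT leFT.
split; first by rewrite szT ellE; lia.
(* Positivity of [X] is obtained from an edge; without edges both sums are empty. *)
- rewrite /weight -sumF; case: (set_0Vmem (edges I)) => [E0|[e0 e0I]].
    have es0 : es = [::].
      by apply: size0nil; rewrite (perm_size esP) -cardE E0 cards0.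
    by rewrite /T /Fs es0 /= !big_nil.
  have X0 := X_gt0 e0I.
  move: topt; rewrite -/T -/Fs !sum_tilde_omega ?gt_eqF // szT szF !sum_multiplicity.
  have -> : (\sum_(C <- comms I) comm_edges C T = \sum_(C <- comms I) comm_edges C Fs)%N.
    apply/eqP; rewrite eqn_leq zopt andbT !big_seq; apply: leq_sum => C Cc.
    by apply: leq_trans (leT _ Cc) (leF _ Cc).
  by rewrite lerD2l lerN2 ler_pM2r // invr_gt0.
- by move=> C Cc; rewrite eqT //; lia.
Qed.

End Optimality.

End Correctness.

(** * Specifications of the subroutines *)

Section Programs.

Variables (R : realFieldType) (V : finType).

Implicit Types (es : seq (edge R V)) (cs : seq {set V}).

Lemma result_bind (A B : Type) (t : timed A) (f : A -> timed B) :
  result (bind t f) = result (f (result t)).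
Proof. by []. Qed.

Lemma cost_bind (A B : Type) (t : timed A) (f : A -> timed B) :
  cost (bind t f) = (cost t + cost (f (result t)))%N.
Proof. by []. Qed.

Lemma cost_ret (A : Type) (a : A) : cost (ret a) = 0%N.
Proof. by []. Qed.

Lemma map_ends_greedy U es :
  map (@ends R V) (greedy (@edge_vec R V) U es) =
  greedy incid U (map (@ends R V) es).
Proof.
elim: es U => //= e es IH U; rewrite -[edge_vec e]/(incid (ends e)).
by case: ifP => _ /=; rewrite IH.
Qed.

(** No term linear in [#|V|] enters the cost, because arrays are allocated only once
    [#|V| <= size es + 1] is known. *)
Lemma connectedT_spec es :
  all (fun e => src e != dst e) es ->
  result (connectedT es) =
    (#|V| <= (\dim <<map incid (map (@ends R V) es)>>).+1)%N /\
  (cost (connectedT es) <=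
     4 * size es + 5 + size es * (2 * trunc_log 2 #|V| + 3))%N.
Proof.
move=> nes; rewrite /connectedT result_bind cost_bind.
have [-> ->] := countT_spec predT es; rewrite count_predT.
have dim_le : (\dim <<map incid (map (@ends R V) es)>> <= size es)%N.
  by apply: leq_trans (dim_span _) _; rewrite !size_map.
case: ltnP => [lt|le].
  split; last by rewrite cost_ret; lia.
  apply/esym/negbTE; rewrite -ltnNge; exact: leq_ltn_trans lt.
have [fr fc] := greedy_forestT_spec nes.
rewrite result_bind cost_bind fr.
have [kr kc] := countT_spec predT (greedy (@edge_vec R V) 0 es).
rewrite result_bind cost_bind kr kc count_predT cost_ret.
split; first by rewrite -size_greedy_dim -map_ends_greedy size_map.
have := size_greedy (@edge_vec R V) 0 es; move: fc le.
move: (trunc_log 2 #|V|) (cost (greedy_forestT es)) #|V| => l cg n.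
by move: (size es * _)%N; lia.
Qed.

Lemma kruskalT_spec (ks : seq (edge R V * R)) j :
  all (fun p => src p.1 != dst p.1) ks -> (size ks <= 2 ^ j)%N ->
  exists ks' : seq (edge R V * R),
  [/\ forall p, count p ks' = count p ks,
      sorted (fun p q => q.2 <= p.2) ks',
      result (kruskalT ks) = greedy (@edge_vec R V) 0 (map fst ks') &
      (cost (kruskalT ks) <= 2 * size ks + 4 + j * (2 * size ks + 2) + 2 * #|V| +
         size ks * (2 * trunc_log 2 #|V| + 3))%N].
Proof.
move=> nks szj; rewrite /kruskalT result_bind cost_bind.
have tot : total (fun p q : edge R V * R => q.2 <= p.2) by move=> p q; apply: le_total.
have [srt cnt /(_ _ szj)] := sortT_spec tot ks.
set ks' := result _ in srt cnt * => sc; exists ks'.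
have sz : size ks' = size ks by rewrite -!(count_predT) cnt.
rewrite result_bind cost_bind.
have [mr mc] := @mapT_spec _ _ (fun p : edge R V * R => ret p.1) 0 ks' (fun=> erefl).
rewrite mr mc -[map _ _]/(map fst ks').
have [|fr fc] := @greedy_forestT_spec R V (map fst ks').
  by rewrite all_map all_count cnt sz -all_count.
split=> //; rewrite size_map sz in fc *; move: sc fc.
move: (trunc_log 2 #|V|) #|V| (cost (greedy_forestT _)) => l n cg.
by move: (j * _)%N (size ks * (_ + _))%N; lia.
Qed.

Lemma is_solutionT_spec cs (l : int) (b : R) (T : seq (edge R V)) :
  result (is_solutionT cs l b T) =
    [&& (size T)%:Z <= l, \sum_(e <- T) wgt e <= b &
        all (fun C : {set V} => #|C| <= (comm_edges C (map (@ends R V) T)).+1)%N cs] /\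
  (cost (is_solutionT cs l b T) <= 2 * size T + 3 + size cs * (#|V| + size T + 3))%N.
Proof.
rewrite /is_solutionT result_bind cost_bind.
have [-> ->] := countT_spec predT T; rewrite count_predT.
rewrite result_bind cost_bind.
have [-> ->] := foldT_spec (fun e (r : R) => wgt e + r) 0 T.
have -> : foldr (fun e (r : R) => wgt e + r) 0 T = \sum_(e <- T) wgt e.
  by elim: T => [|e T IH]; rewrite ?big_nil ?big_cons //= IH.
have commP C : result (comm_connectedT T C) =
      (#|C| <= (comm_edges C (map (@ends R V) T)).+1)%N /\
    cost (comm_connectedT T C) = (#|V| + size T + 2)%N.
  rewrite /comm_connectedT result_bind cost_bind.
  have [-> ->] := countT_spec (fun v => v \in C) (enum V).
  rewrite result_bind cost_bind.
  have [-> ->] := countT_spec (fun e => (src e \in C) && (dst e \in C)) T.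
  rewrite cost_ret -cardE; split; last by move: #|V| => n; lia.
  rewrite /result /=; congr (_ <= _.+1)%N.
    by rewrite cardE -size_filter enumT.
  rewrite /comm_edges count_map; apply: eq_count => e /=.
  by rewrite /ends subUset !sub1set.
have /(_ cs) := @cost_allT _ (comm_connectedT T) (#|V| + size T + 2).
have -> : ((#|V| + size T + 2).+1 = #|V| + size T + 3)%N by lia.
move: (size cs * _)%N => q allc.
case: andP => [[-> ->]|nlb]; last first.
  split; last by rewrite cost_ret; lia.
  by rewrite /result /=; apply/esym/and3P => -[? ? _]; apply: nlb.
rewrite result_allT; split; first by apply: eq_all => C; case: (commP C).
suff /allc : forall C, (cost (comm_connectedT T C) <= #|V| + size T + 2)%N by lia.
by move=> C; case: (commP C) => _ ->.
Qed.

End Programs.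

(** There are at most [#|V|^2] edges, and [#|V|] is below 2 to the power [trunc_log 2 #|V| + 1]. The
    exponent serves as the number of merge rounds. *)
Lemma card_edges_le (R : realFieldType) (V : finType) (I : cnws R V) :
  (#|edges I| <= 2 ^ (2 * (trunc_log 2 #|V|).+1))%N.
Proof.
have sub : edges I \subset [set e : {set V} | #|e| == 2].
  by apply/subsetP => e /edges_card2; rewrite inE => ->.
apply: leq_trans (subset_leq_card sub) _; rewrite card_draws bin2.
apply: (@leq_trans (#|V| * #|V|)).
  by rewrite -divn2; apply: leq_trans (leq_div _ _) _; rewrite leq_mul2l leq_pred orbT.
rewrite mul2n -addnn expnD.
by apply: leq_mul; apply/ltnW/trunc_log_ltn.
Qed.

Lemma foldr_max_ge (A : Type) (R : realFieldType) (w : A -> R) (s : seq A) :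
  all (fun x => w x <= foldr (fun y r => Num.max (w y) r) 0 s) s.
Proof.
elim: s => //= x s IH; rewrite le_max lexx /=.
by apply: sub_all IH => y le; rewrite le_max le orbT.
Qed.

(** * Correctness and running time of the whole algorithm *)

Section Algorithm.

Variables (R : realFieldType) (V : finType) (I : cnws R V) (es : seq (edge R V)).
Hypothesis ellE : ell I = #|V|%:Z - 1.
Hypothesis hyp : hypergraph_connected (comms I).
Hypothesis esI : encodes I es.

Local Notation run := (algorithm es (comms I) (ell I) (budget I)).
Local Notation m := #|edges I|.
Local Notation c := (size (comms I)).
Local Notation L := (trunc_log 2 #|V|).

Lemma size_encoding : size es = m.
Proof. by rewrite -(size_map (@ends R V)) (perm_size esI.1) -cardE. Qed.

Lemma encoding_valid :
  all (fun e => (ends e \in edges I) && (wgt e == omega I (ends e))) es.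
Proof.
have [perm] := esI.
have : all (fun f => f \in edges I) (map (@ends R V) es).
  by apply/allP => f; rewrite (perm_mem perm) mem_enum.
elim: (es) => //= e s IH /andP[-> all_s] [-> /IH ->] //.
by rewrite eqxx.
Qed.

Lemma encoding_no_loop : all (fun e => src e != dst e) es.
Proof.
apply: sub_all encoding_valid => e /andP[/edges_card2]; rewrite cards2.
by case: eqP.
Qed.

Definition maxw1 : R := foldr (fun e r => Num.max (wgt e) r) 0 es + 1.

Lemma omega_lt_maxw1 e : e \in edges I -> omega I e < maxw1.
Proof.
rewrite -mem_enum -(perm_mem esI.1) /maxw1.
move: (foldr_max_ge (@wgt R V) es) encoding_valid; move: (foldr _ _ _) => M.
elim: (es) => //= f s IH /andP[leM sM] /andP[/andP[_ /eqP wE] sE].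
rewrite inE => /orP[/eqP->|]; last exact: IH.
by rewrite -wE ltr_pwDr.
Qed.

Lemma maxweight1T_spec :
  result (maxweight1T es) = maxw1 /\ cost (maxweight1T es) = m.+1.
Proof.
rewrite /maxweight1T result_bind cost_bind -size_encoding.
have [-> ->] := foldT_spec (fun e (r : R) => Num.max (wgt e) r) 0 es.
by rewrite cost_ret addn0.
Qed.

Definition keyed_edges : seq (edge R V * R) :=
  [seq (e, tilde_omega I maxw1 (ends e)) | e <- es].

Lemma keyed_edgesT_spec :
  let t := mapT (fun e => let* w := tilde_omegaT (comms I) maxw1 e in ret (e, w)) es in
  result t = keyed_edges /\ cost t = (m * c.+2).+1.
Proof.
rewrite -size_encoding /=; set f := fun e => _.
have fP e : result (f e) =
      (e, (multiplicity I (ends e))%:R + (maxw1 - wgt e) / maxw1) /\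
    cost (f e) = c.+1.
  rewrite /f /tilde_omegaT result_bind cost_bind result_bind cost_bind.
  have [-> ->] := countT_spec (fun C : {set V} => (src e \in C) && (dst e \in C)) (comms I).
  rewrite /result !cost_ret !addn0 /=; split=> //; congr (_, _%:R + _).
  by apply: eq_count => C; rewrite /ends subUset !sub1set.
have [-> ->] := mapT_spec es (fun e => (fP e).2); split=> //.
rewrite /keyed_edges; elim: (es) encoding_valid => // e s IH /andP[/andP[_ /eqP wE] /IH sE].
by rewrite !map_cons (fP e).1 wE sE.
Qed.

Lemma kruskal_tree_spec :
  exists es' : seq (edge R V),
  [/\ perm_eq (map (@ends R V) es') (enum (edges I)),
      all (fun e => wgt e == omega I (ends e)) es',
      pairwise (fun e f => tilde_omega I maxw1 f <= tilde_omega I maxw1 e)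
        (map (@ends R V) es'),
      result (kruskalT keyed_edges) = greedy (@edge_vec R V) 0 es' &
      (cost (kruskalT keyed_edges) <=
         2 * m + 4 + (2 * L.+1) * (2 * m + 2) + 2 * #|V| + m * (2 * L + 3))%N].
Proof.
have [||ks' [cnt srt res cst]] := @kruskalT_spec R V keyed_edges (2 * L.+1).
- by rewrite all_map; apply: encoding_no_loop.
- by rewrite size_map size_encoding card_edges_le.
rewrite size_map size_encoding in cst.
have sz : size ks' = size keyed_edges by rewrite -!count_predT cnt.
have all_cnt (p : pred (edge R V * R)) : all p keyed_edges -> all p ks'.
  by rewrite !all_count cnt sz.
exists (map fst ks'); split=> //.
- apply: perm_trans esI.1; apply/permP => p; rewrite !count_map cnt.
  by rewrite /keyed_edges count_map.
- rewrite all_map; apply: all_cnt; rewrite all_map.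
  by apply: sub_all encoding_valid => e /andP[].
rewrite -map_comp pairwise_map.
have tr : transitive (fun p q : edge R V * R => q.2 <= p.2).
  by move=> p q r /= qp rp; apply: le_trans rp qp.
rewrite (sorted_pairwise tr) in srt.
(* Each stored key is [tilde_omega] of its edge. Sorting preserves counts and hence this property,
   so the order of the keys becomes an order of the edges. *)
pose keyed (p : edge R V * R) := p.2 == tilde_omega I maxw1 (ends p.1).
apply: (sub_in_pairwise (P := keyed)) srt.
  by move=> p q /eqP pE /eqP qE /=; rewrite pE qE.
by apply: all_cnt; rewrite all_map; apply/sub_all: encoding_valid => e _ /=; apply: eqxx.
Qed.

Lemma algorithm_correct :
  match result run with
  | Some T => min_weight_solution I (edge_set T)
  | None => forall F : {set {set V}}, ~ solution I F
  end.
Proof.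
rewrite /algorithm result_bind.
have [-> _] := connectedT_spec encoding_no_loop.
case: ifPn => [|_].
  (* A solution would make the edges span dimension [#|V| - 1], against the failed connectivity
     test. *)
  rewrite -ltnNge => nconn F FP.
  have [n0 _ _ dimE] := solution_spanning_tree esI.1 ellE hyp FP.
  by move: nconn; rewrite dimE prednK // ltnn.
rewrite result_bind; have [-> _] := maxweight1T_spec.
rewrite result_bind.
have [-> _] := keyed_edgesT_spec.
rewrite result_bind; have [es' [perm wE srt -> _]] := kruskal_tree_spec.
rewrite result_bind; have [-> _] := is_solutionT_spec (comms I) (ell I) (budget I)
  (greedy (@edge_vec R V) 0 es').
set T := greedy _ _ _.
have TE : map (@ends R V) T = greedy incid 0 (map (@ends R V) es').
  exact: map_ends_greedy.
have wT : \sum_(e <- T) wgt e =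
          \sum_(f <- greedy incid 0 (map (@ends R V) es')) omega I f.
  rewrite -TE big_map /T.
  elim: (es') wE (0%VS) => [|e s IH] /= => [_ U|/andP[/eqP wE /IH{}IH] U].
    by rewrite !big_nil.
  by case: ifP => _; rewrite ?big_cons ?wE IH.
have beats F (FP : solution I F) := kruskal_beats_solution perm ellE hyp FP omega_lt_maxw1 srt.
have sol := kruskal_solution perm.
rewrite /result /=; case: and3P => [[szT bT /allP commT]|no].
  rewrite wT TE -(size_map (@ends R V)) TE in szT bT commT.
  have [solT weightT] := sol szT bT commT.
  rewrite /edge_set TE; split=> // F /(beats F)[_ le _].
  by rewrite weightT.
(* If some [F] is a solution, [T] passes every check; a failed check therefore excludes all
   solutions. *)
move=> F FP; have [szT le commT] := beats F FP; apply: no.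
rewrite wT TE -(size_map (@ends R V)) TE; split=> //; last exact/allP.
by case: FP => _ _ wF _; apply: le_trans le wF.
Qed.

(** Some steps are spent even if [m] or [c + L] is 0, whence [maxn 1]. *)
Lemma algorithm_cost :
  (cost run <= 120 * (maxn 1 m * maxn 1 (c + L)))%N.
Proof.
(* Each of the two factors [k + 1] is at most [2 * maxn 1 k], which turns 30 into 120. *)
suff : (cost run <= 30 * (m.+1 * (c + L).+1))%N.
  move=> le; apply: leq_trans le _.
  have le1 (k : nat) : (k.+1 <= 2 * maxn 1 k)%N by lia.
  have := leq_mul (le1 m) (le1 (c + L)%N).
  move: (maxn 1 m) (maxn 1 _) (m.+1 * _)%N; lia.
rewrite /algorithm cost_bind.
have [cr cc] := connectedT_spec encoding_no_loop; rewrite cr.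
rewrite size_encoding in cc.
case: ifPn => [_|/negPn conn].
  rewrite cost_ret; move: cc.
  move: (cost (connectedT es)) m c L; lia.
(* Past the connectivity test, array allocation and the vertex counts for the communities are
   absorbed by [m]. *)
have le_n : (#|V| <= m.+1)%N.
  apply: leq_trans conn _; rewrite ltnS; apply: leq_trans (dim_span _) _.
  by rewrite !size_map size_encoding.
rewrite cost_bind; have [-> ->] := maxweight1T_spec.
rewrite cost_bind.
have [-> ->] := keyed_edgesT_spec.
rewrite cost_bind; have [es' [perm _ _ -> kc]] := kruskal_tree_spec.
rewrite cost_bind cost_ret.
have [_] := is_solutionT_spec (comms I) (ell I) (budget I)
  (greedy (@edge_vec R V) 0 es').
have := size_greedy (@edge_vec R V) 0 es'.
have -> : size es' = m by rewrite -(size_map (@ends R V)) (perm_size perm) -cardE.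
move: cc kc le_n.
move: (cost (connectedT es)) (cost (kruskalT _)) (cost (is_solutionT _ _ _ _)).
move: (size (greedy _ _ _)) #|V| L m c => t n l k s c1 c2 c3 h1 h2 h3 h4 h5.
have h6 : (s * (n + t + 3) <= s * (2 * k + 4))%N by rewrite leq_mul2l; lia.
nia.
Qed.

End Algorithm.

Theorem theorem19 :
  exists K : nat,
  forall (R : realType) (V : finType) (I : cnws R V) (es : seq (edge R V)),
    ell I = #|V|%:Z - 1 ->
    hypergraph_connected (comms I) ->
    encodes I es ->
    let n := #|V| in
    let m := #|edges I| in
    let c := size (comms I) in
    let run := algorithm es (comms I) (ell I) (budget I) in
    (cost run <= K * (maxn 1 m * maxn 1 (c + trunc_log 2 n)))%N /\
    match result run with
    | Some T => min_weight_solution I (edge_set T)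
    | None => forall F : {set {set V}}, ~ solution I F
    end.
Proof.
exists 120 => R V I es ellE hyp esI; split; first exact: algorithm_cost.
exact: algorithm_correct.
Qed.
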